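(* Let $X\subset\mathbb{Q}\times\mathbb{Q}$ be a digital topology space with a sequence of video frames $\{fr_t\}_{t\in[t_0,t_1]}$, let $\varepsilon\ge 0$, and let $A, B\subseteq X$ be subimages with common lifespan $[t_0,t_1]$. If $A$ and $B$ are temporally near, $A\ \delta_t\ B$, then they are temporally $\varepsilon$-near, $A\ \delta_\varepsilon\ B$.
   Context: A video on $X$ is a time-indexed family of frames $fr_t : X\to\mathbb{R}$, $t\in[t_0,t_1]$. For a subimage (nonempty subset) $A\subseteq X$, $A_t\subseteq X$ denotes the position of $A$ at time $t$, so that a subimage with lifespan $[t_0,t_1]$ gives a family $(A_t)_{t\in[t_0,t_1]}$ of nonempty subsets of $X$. Temporal discrete proximity: $A\ \delta_t\ B$ (temporally near) if and only if $\{t\in[t_0,t_1] : A_t\cap B_t\neq\emptyset\}\neq\emptyset$. For nonempty $C,C'\subseteq X$ and $\varepsilon\ge0$, $C$ and $C'$ are $\varepsilon$-near if $D(C,C')\le\varepsilon$, where $D(C,C')=\inf\{\|c-c'\| : c\in C, c'\in C'\}$ is the gap distance for the Euclidean metric. Temporal metric proximity: $A\ \delta_\varepsilon\ B$ (temporally $\varepsilon$-near) if and only if $\{t\in[t_0,t_1] : A_t \text{ and } B_t \text{ are } \varepsilon\text{-near}\}\neq\emptyset$. *)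

(* Defs.v *)
From HB Require Import structures.
From mathcomp Require Import all_boot all_order all_algebra.
From mathcomp Require Import all_classical all_reals all_analysis.
Set Implicit Arguments.
Unset Strict Implicit.
Unset Printing Implicit Defensive.
Import Order.TTheory GRing.Theory Num.Theory.
Local Open Scope classical_set_scope.
Local Open Scope ring_scope.

(* The topology is an arbitrary one on the carrier; it need not be the one
   induced by the Euclidean metric. *)
Record digital_space := DigitalSpace {
  pixels :> set (rat * rat);
  pixel_topology : Topological pixels
}.

Definition video (R : realType) (X : digital_space) (t0 t1 : R) :=
  `[t0, t1]%classic -> X -> R.

(* [position A t] is the set written A_t; its values at times outside
   [t0, t1] are unconstrained and never used. *)
Record subimage (R : realType) (X : digital_space) (t0 t1 : R) := Subimage {
  shape : set (rat * rat);
  shape_sub : shape `<=` X;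
  shape_nonempty : shape !=set0;
  position : R -> set (rat * rat);
  position_sub : forall t, t \in `[t0, t1] -> position t `<=` X;
  position_nonempty : forall t, t \in `[t0, t1] -> position t !=set0
}.

Definition euclidean_norm (R : realType) (v : rat * rat) : R :=
  Num.sqrt (ratr v.1 ^+ 2 + ratr v.2 ^+ 2).

(* [inf] is a real number, equal to 0 on the empty set, so this is the gap
   distance only for nonempty [C] and [C']. *)
Definition gap (R : realType) (C C' : set (rat * rat)) : R :=
  inf [set euclidean_norm R (c - c') | c in C & c' in C'].

Definition eps_near (R : realType) (eps : R) (C C' : set (rat * rat)) : Prop :=
  gap R C C' <= eps.

Definition temporally_near (R : realType) (X : digital_space) (t0 t1 : R)
    (A B : subimage X t0 t1) : Prop :=
  [set t | t \in `[t0, t1] /\ position A t `&` position B t !=set0] !=set0.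

Definition temporally_eps_near (R : realType) (X : digital_space) (t0 t1 : R)
    (eps : R) (A B : subimage X t0 t1) : Prop :=
  [set t | t \in `[t0, t1] /\ eps_near eps (position A t) (position B t)]
    !=set0.

(* Main.v *)
Require Import Defs.
From mathcomp Require Import all_boot all_order all_algebra.
From mathcomp Require Import all_classical all_reals all_analysis.
Import Order.TTheory GRing.Theory Num.Theory.
Local Open Scope ring_scope.

(** At a time when the two positions share a point [c], the pair [(c, c)] contributes distance 0, so
    the gap is at most 0 ([gap_meet_le0]), hence at most [eps]. The same time thus witnesses both
    relations. *)

Lemma euclidean_norm0 (R : realType) : euclidean_norm R 0 = 0.
Proof. by rewrite /euclidean_norm /= raddf0 expr0n /= addr0 sqrtr0. Qed.

Lemma gap_meet_le0 (R : realType) (C C' : set (rat * rat)) :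
  (C `&` C' !=set0)%classic -> gap R C C' <= 0.
Proof.
move=> [c [Cc C'c]]; apply: ge_inf.
  (* An infimum lies below each member only if the set is bounded below; 0 is a bound, as every
     distance is a square root. *)
  by exists 0 => _ [x _ [y _ <-]]; exact: sqrtr_ge0.
by exists c => //; exists c => //; rewrite subrr euclidean_norm0.
Qed.

Theorem proposition5 (R : realType) (X : digital_space) (t0 t1 : R)
    (ht : t0 <= t1) (fr : video X t0 t1) (eps : R) (heps : 0 <= eps)
    (A B : subimage X t0 t1) :
  temporally_near A B -> temporally_eps_near eps A B.
Proof.
move=> [t [tI AB]]; exists t; split=> //.
exact: le_trans (gap_meet_le0 R _ _ AB) heps.
Qed.
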